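(* Let $d\ge 1$ and $k\ge 2$ be fixed integers and let $\varepsilon>0$ and $C>0$ be fixed. Let $q=p^\ell$ be a power of an odd prime $p$ (with $\ell\ge1$ an integer), let $E\subseteq \mathbb Z_q^d$, and let $\alpha=(\alpha_1,\dots,\alpha_k)\in\mathbb Z_q^k$ be a $k$-tuple of units of $\mathbb Z_q$. If $$|E|\ge C q^{\varepsilon}\, q^{\frac{d(2\ell-1)+1}{2\ell}+\frac{k-2}{2}},$$ then $$|\Pi_\alpha(E)|=(1+o(1))\frac{|E|^{k+1}}{q^k},$$ where $o(1)$ denotes a quantity tending to $0$ as $q\to\infty$ (with $d,k,\varepsilon,C$ fixed), uniformly over all such $E$ and $\alpha$.
   Context: $\mathbb Z_q=\mathbb Z/q\mathbb Z$ is the ring of integers modulo $q$, $\mathbb Z_q^d$ is the free module of rank $d$ over it, and $x\cdot y=\sum_{i=1}^d x_iy_i\in\mathbb Z_q$ for $x,y\in\mathbb Z_q^d$. For a sequence $\alpha=(\alpha_1,\dots,\alpha_k)$ of elements of $\mathbb Z_q$, a dot product $k$-chain (of type $\alpha$) is a $(k+1)$-tuple of distinct points $(x_1,\dots,x_{k+1})$ with $x_j\cdot x_{j+1}=\alpha_j$ for every $1\le j\le k$. For $E\subseteq\mathbb Z_q^d$, $\Pi_\alpha(E)$ is the set of dot product $k$-chains of type $\alpha$ all of whose points lie in $E$. Throughout, $k$ is treated as a constant. *)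

(* Defs.v *)
From HB Require Import structures.
From mathcomp Require Export all_boot all_order all_algebra.
From mathcomp Require Export all_reals exp.

Set Implicit Arguments.
Unset Strict Implicit.
Unset Printing Implicit Defensive.

Import GRing.Theory Num.Theory.
Local Open Scope ring_scope.

(* 'Z_q is the ring of integers modulo q only for q > 1; the definitions below
   are meant to be used at such q. *)

Definition dotp (q d : nat) (x y : 'rV['Z_q]_d) : 'Z_q :=
  \sum_(i < d) x ord0 i * y ord0 i.

(* Points are indexed from 0, so that the j-th condition relates the entries
   j and j.+1 of the tuple. *)
Definition dot_chain (q d k : nat) (alpha : k.-tuple 'Z_q)
    (x : k.+1.-tuple 'rV['Z_q]_d) : bool :=
  uniq x &&
  [forall j : 'I_k,
     dotp (tnth x (widen_ord (leqnSn k) j)) (tnth x (lift ord0 j))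
       == tnth alpha j].

Definition dot_chains (q d k : nat) (alpha : k.-tuple 'Z_q)
    (E : {set 'rV['Z_q]_d}) : {set k.+1.-tuple 'rV['Z_q]_d} :=
  [set x | dot_chain alpha x & [forall j, tnth x j \in E]].

(* Main.v *)
From HB Require Import structures.
Require Import Defs.
From mathcomp Require Import ring lra zify.

Set Implicit Arguments.
Unset Strict Implicit.
Unset Printing Implicit Defensive.

Import Order.TTheory GRing.Theory Num.Theory.
Local Open Scope ring_scope.

(* For a unit a of Z_q, q = p^l, let M(x, y) = [x.y = a] - 1/q on Z_q^d.
   If some 2x2 minor of (x, x') is a unit, then y |-> (x.y, x'.y) is onto, and
   the entry at (x, x') of M M^T vanishes. Otherwise x.y = x'.y = a forces
   x' - x to have all its entries in the maximal ideal I of nonunits; counting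
   such x' along y, through the fibres of u |-> u.y from I^d onto I, bounds the
   absolute row sums of M M^T by 2 (q |I|)^(d-1), with |I| = q/p. Hence M has
   norm at most L = (2 q^(2(d-1)) / p^(d-1))^(1/2), which is o(|E|/q) under the
   hypothesis on |E|.
   Iterating, the walks of length k in E number |E| (|E|/q + O(L))^k. A walk
   whose j-th point repeats an earlier one has one free point fewer, and dropping
   the at most two constraints at that point bounds the number of such walks by
   O(q^2/|E|) of the main term, or O(q/|E|) when one constraint is dropped. This
   is negligible since |E| >> q, and |E| >> q^2 once k >= 3; for k = 2 dropping
   one constraint always suffices. *)

(** * Fibres of additive maps between finite abelian groups *)

HB.instance Definition _ (U W : finZmodType) := GRing.Zmodule.on (U * W)%type.

(** [G] is a subgroup, and translation by a difference of preimages carries one fibre onto another,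
    so the fibres over [H] partition [G] into equal parts. *)
Lemma card_fiber (U W : finZmodType) (f : U -> W) (G : {set U}) (H : {set W}) :
  {morph f : u v / u - v} ->
  {in G &, forall u v, u - v \in G} ->
  f @: G = H ->
  forall w, w \in H -> (#|[set u in G | f u == w]| * #|H| = #|G|)%N.
Proof.
move=> fB GB <- w /imsetP[u0 Gu0 ->{w}].
have GD : {in G &, forall u v, u + v \in G}.
  move=> u v Gu Gv; rewrite -[v]opprK; apply: (GB) => //.
  by rewrite -[- v]sub0r -(subrr v); apply: (GB) => //; apply: (GB).
have fibE w' : w' \in f @: G ->
    #|[set u in G | f u == w']| = #|[set u in G | f u == f u0]|.
  case/imsetP=> u1 Gu1 ->{w'}.
  rewrite -(card_imset _ (addIr (u0 - u1))); apply: eq_card => u.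
  apply/imsetP/idP.
    case=> v; rewrite !inE => /andP[Gv /eqP fv] ->.
    rewrite GD ?GB //= addrC -[v]opprK fB fB.
    by rewrite -[- v]sub0r fB fv -(subrr u0) fB subrr sub0r opprK subrK.
  rewrite !inE => /andP[Gu /eqP fu]; exists (u - (u0 - u1)); last by rewrite subrK.
  by rewrite !inE !GB //= !fB fu opprB addrCA subrr addr0.
rewrite -[RHS]sum1_card (partition_big_imset f) /= mulnC -sum_nat_const.
apply: eq_bigr => w' Hw'; rewrite -(fibE w' Hw') -sum1_card.
by apply: eq_bigl => u; rewrite inE.
Qed.

(** * Dot products over a finite commutative ring *)

Section Dot.
Variables (A : finComUnitRingType) (d : nat).
Implicit Types x y u v : 'rV[A]_d.

Definition dot x y : A := \sum_(i < d) x ord0 i * y ord0 i.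

Lemma dotC x y : dot x y = dot y x.
Proof. by apply: eq_bigr => i _; rewrite mulrC. Qed.

Lemma dotDr x u v : dot x (u + v) = dot x u + dot x v.
Proof. by rewrite /dot -big_split; apply: eq_bigr => i _; rewrite mxE mulrDr. Qed.

Lemma dotZr x c v : dot x (c *: v) = c * dot x v.
Proof. by rewrite /dot mulr_sumr; apply: eq_bigr => i _; rewrite mxE mulrCA. Qed.

Lemma dotBr x u v : dot x (u - v) = dot x u - dot x v.
Proof. by rewrite dotDr -scaleN1r dotZr mulN1r. Qed.

Lemma dotBl x u v : dot (u - v) x = dot u x - dot v x.
Proof. by rewrite ![dot _ x]dotC dotBr. Qed.

Lemma dotZl x c v : dot (c *: v) x = c * dot v x.
Proof. by rewrite ![dot _ x]dotC dotZr. Qed.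

Lemma dot_delta x i : dot x (delta_mx ord0 i) = x ord0 i.
Proof.
rewrite /dot (bigD1 i) //= mxE !eqxx mulr1 big1 ?addr0 // => j /negbTE jNi.
by rewrite mxE jNi andbF mulr0.
Qed.

Definition prim x := [exists i, x ord0 i \is a GRing.unit].

Definition minor x y i j : A := x ord0 i * y ord0 j - x ord0 j * y ord0 i.

(** Over a local ring: the reductions of [x] and [y] modulo the maximal ideal are linearly dependent
    over the residue field. *)
Definition dep x y := [forall i, forall j, minor x y i j \isn't a GRing.unit].

Lemma card_dot x a : prim x ->
  (#|[set y | dot x y == a]| * #|A| = #|A| ^ d)%N.
Proof.
case/existsP=> i xi.
have := @card_fiber _ _ (dot x) [set: 'rV[A]_d] [set: A] _ _ _ a (in_setT a).
rewrite !cardsT card_mx mul1n => <- //.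
- by congr (_ * _)%N; apply: eq_card => y; rewrite !inE.
- by move=> u v; rewrite dotBr.
- by move=> u v; rewrite !in_setT.
- apply/setP=> b; rewrite inE; apply/imsetP.
  exists ((b / x ord0 i) *: delta_mx ord0 i); rewrite ?inE //.
  by rewrite dotZr dot_delta divrK.
Qed.

Lemma card_dot2 x x' a b : ~~ dep x x' ->
  (#|[set y | (dot x y == a) && (dot x' y == b)]| * #|A| ^ 2 = #|A| ^ d)%N.
Proof.
rewrite negb_forall => /existsP[i]; rewrite negb_forall => /existsP[j].
rewrite negbK => Du; set D := minor _ _ _ _ in Du.
have := @card_fiber _ (A * A)%type (fun y => (dot x y, dot x' y))
  [set: 'rV[A]_d] [set: A * A] _ _ _ (a, b) (in_setT _).
rewrite !cardsT card_mx mul1n card_prod mulnn => <- //.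
- by congr (_ * _)%N; apply: eq_card => y; rewrite !inE.
- by move=> u v; rewrite !dotBr.
- by move=> u v; rewrite !in_setT.
- apply/setP=> [[s t]]; rewrite inE; apply/imsetP.
  (* Cramer's rule for the two equations, with [y] supported on the coordinates [i] and [j]. *)
  exists (((s * x' ord0 j - t * x ord0 j) / D) *: delta_mx ord0 i
     + ((x ord0 i * t - x' ord0 i * s) / D) *: delta_mx ord0 j); rewrite ?inE //.
  rewrite !dotDr !dotZr !dot_delta.
  have DK n z : n / D * z * D = n * z by rewrite mulrAC divrK.
  by congr (_, _); apply: (mulIr Du); rewrite mulrDl !DK /D /minor; ring.
Qed.

Lemma dot_unit_prim x y :
  {in [predC GRing.unit] &, forall s t : A, s + t \isn't a GRing.unit} ->
  dot x y \is a GRing.unit -> prim x.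
Proof.
move=> loc; apply: contraLR; rewrite negb_exists => /forallP xN.
rewrite /dot; elim/big_ind: _ => [|s t|i _]; first by rewrite unitr0.
- exact: loc.
- by rewrite unitrM negb_and xN.
Qed.

End Dot.

(** * Counting over a local ring, in rank [d.+1] *)

Definition local_ring (A : unitRingType) :=
  {in [predC GRing.unit] &, forall s t : A, s + t \isn't a GRing.unit}.

Definition nonunits (A : finUnitRingType) : {set A} :=
  [set a | a \isn't a GRing.unit].

Section Local.
Variables (A : finComUnitRingType) (d : nat).
Hypothesis locA : local_ring A.
Let q := #|A|.
Let m := #|nonunits A|.
Implicit Types x y u v : 'rV[A]_d.+1.

Lemma nonunits_gt0 : (0 < m)%N.
Proof. by apply/card_gt0P; exists 0; rewrite inE unitr0. Qed.

Lemma nonunits_le : (m <= q)%N.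
Proof. exact: max_card. Qed.

Lemma primPn x : reflect (forall i, x ord0 i \isn't a GRing.unit) (~~ prim x).
Proof. by rewrite negb_exists; apply: forallP. Qed.

Lemma nonprimB u v : ~~ prim u -> ~~ prim v -> ~~ prim (u - v).
Proof.
move=> /primPn uN /primPn vN; apply/primPn => i; rewrite !mxE.
by apply: locA; rewrite !inE ?unitrN.
Qed.

Lemma card_nonprim : #|[set u : 'rV[A]_d.+1 | ~~ prim u]| = (m ^ d.+1)%N.
Proof.
rewrite -[in RHS](card_ord d.+1) -card_ffun_on.
have rI : injective (fun f : {ffun 'I_d.+1 -> A} => \row_i f i).
  by move=> f g /rowP fg; apply/ffunP => i; have := fg i; rewrite !mxE.
rewrite -(card_image rI); apply: eq_card => u; rewrite inE.
apply/idP/imageP => [/primPn uN | [f /ffun_onP fN ->]].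
  exists [ffun i => u ord0 i]; last by apply/rowP=> i; rewrite mxE ffunE.
  by apply/ffun_onP => i; rewrite ffunE inE.
by apply/primPn => i; have := fN i; rewrite mxE inE.
Qed.

(** With I the ideal of nonunits, a unit entry of [y] makes [dot y] map I^(d+1) onto I; this is its
    fibre over 0. *)
Lemma card_nonprim_dot y :
  prim y -> #|[set u | ~~ prim u & dot y u == 0]| = (m ^ d)%N.
Proof.
move=> /existsP[i yi]; apply/eqP; rewrite -(eqn_pmul2r nonunits_gt0) -expnSr.
rewrite -card_nonprim; apply/eqP.
rewrite -(@card_fiber _ _ (dot y) [set u | ~~ prim u] (nonunits A) _ _ _ 0).
- by congr (_ * _)%N; apply: eq_card => u; rewrite !inE.
- by move=> u v; rewrite dotBr.
- by move=> u v; rewrite !inE; exact: nonprimB.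
- apply/setP => a; rewrite inE; apply/imsetP/idP => [[u uN ->]|aN].
    by apply: contraL uN; rewrite inE negbK dotC; apply: dot_unit_prim.
  exists ((a / y ord0 i) *: delta_mx ord0 i); last by rewrite dotZr dot_delta divrK.
  rewrite inE; apply/primPn => j; rewrite !mxE unitrM negb_and.
  by rewrite unitrM negb_and aN.
- by rewrite inE unitr0.
Qed.

(** Subtracting from [x'] the multiple of [x] that clears entry [i] leaves entries of the form minor
    over [x_i], hence nonunits: q multipliers and m^d remainders. *)
Lemma card_dep x : prim x -> (#|[set x' | dep x x']| <= q * m ^ d)%N.
Proof.
move=> /existsP[i xi].
(* Vanishing of entry [i] is orthogonality to a basis vector, so [card_nonprim_dot] counts the
   remainders. *)
have pd : prim (delta_mx ord0 i : 'rV[A]_d.+1).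
  by apply/existsP; exists i; rewrite mxE !eqxx unitr1.
rewrite -(card_nonprim_dot pd) /q -cardsT -cardsX.
apply: leq_trans (leq_imset_card (fun cw => cw.1 *: x + cw.2) _).
apply/subset_leq_card/subsetP => x'; rewrite inE => /forallP/(_ i)/forallP dx.
apply/imsetP; exists (x' ord0 i / x ord0 i, x' - (x' ord0 i / x ord0 i) *: x).
  rewrite !inE /= dotC dot_delta !mxE divrK // subrr eqxx andbT.
  apply/primPn => j; rewrite !mxE.
  have -> : x' ord0 j - x' ord0 i / x ord0 i * x ord0 j
            = (x ord0 i)^-1 * minor x x' i j.
    by rewrite /minor mulrBr mulKr //; congr (_ - _); ring.
  by rewrite unitrMr ?unitrV // dx.
by rewrite /= addrC subrK.
Qed.

(** The entries of x_i x' - x'_i x are minors, so its dot product with [y], equal to a (x_i - x'_i),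
    is a nonunit; the unit [a] cancels. *)
Lemma dep_dot_eq x x' y a : a \is a GRing.unit ->
  dep x x' -> dot x y = a -> dot x' y = a -> ~~ prim (x' - x).
Proof.
move=> ua /forallP dx xy x'y; apply/primPn => i.
have: dot (x ord0 i *: x' - x' ord0 i *: x) y \isn't a GRing.unit.
  rewrite (contra (dot_unit_prim locA)) //; apply/primPn => j.
  by have /forallP/(_ j) := dx i; rewrite /minor !mxE [x ord0 j * _]mulrC.
rewrite dotBl !dotZl xy x'y -mulrBl unitrM ua andbT -unitrN opprB.
by rewrite !mxE.
Qed.

(** Summing over [y] first: there are q^d points with x.y = a, and for each of them x' - x is a
    nonunit vector orthogonal to [y], which leaves m^d choices. *)
Lemma sum_codegree_dep x a : a \is a GRing.unit -> prim x ->
  (\sum_(x' | dep x x') #|[set y | (dot x y == a) && (dot x' y == a)]|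
     <= q ^ d * m ^ d)%N.
Proof.
move=> ua px.
under eq_bigr do rewrite -sum1_card.
rewrite (exchange_big_dep (fun y => dot x y == a)) /=; last first.
  by move=> x' y _; rewrite inE => /andP[].
have -> : (q ^ d * m ^ d = \sum_(y | dot x y == a) m ^ d)%N.
  rewrite sum_nat_const; congr (_ * _)%N; apply/eqP.
  rewrite -(@eqn_pmul2r q); last by apply/card_gt0P; exists 0.
  by rewrite -expnSr -(card_dot a px) cardsE.
apply: leq_sum => y /eqP xy.
have py : prim y by apply: (dot_unit_prim locA (y := x)); rewrite dotC xy.
rewrite -(card_nonprim_dot py) -(card_imset _ (addIr x)) sum1_card.
apply/subset_leq_card/subsetP => x'; rewrite unfold_in inE => /and3P[dx _ /eqP x'y].
apply/imsetP; exists (x' - x); last by rewrite subrK.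
by rewrite inE (dep_dot_eq ua dx xy x'y) dotC dotBl x'y xy subrr eqxx.
Qed.

End Local.

(** * Cauchy-Schwarz and the Schur test *)

Lemma sum_indicator (F : pzSemiRingType) (T : finType) (P : pred T) :
  \sum_x (P x)%:R = #|[set x | P x]|%:R :> F.
Proof.
rewrite -sum1_card natr_sum [RHS]big_mkcond; apply: eq_bigr => x _.
by rewrite inE; case: (P x).
Qed.

Lemma sum_sqr_Cauchy (F : rcfType) (T : finType) (f g : T -> F) :
  (\sum_x f x * g x) ^+ 2 <= (\sum_x f x ^+ 2) * (\sum_x g x ^+ 2).
Proof.
(* The factor 2 prepares Lagrange's identity, which writes the doubled difference as a sum of
   squares over all pairs. *)
rewrite -subr_ge0 -(@pmulr_rge0 _ 2) //.
have -> : 2 * ((\sum_x f x ^+ 2) * (\sum_x g x ^+ 2) - (\sum_x f x * g x) ^+ 2)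
  = \sum_x \sum_y (f x * g y - f y * g x) ^+ 2.
  rewrite mulrBr mulr2n mulrDl mul1r.
  rewrite [X in _ + X - _]mulrC expr2 !mulr_suml mulr_sumr -big_split -sumrB /=.
  apply: eq_bigr => x _; rewrite mulrA !mulr_sumr -big_split -sumrB /=.
  by apply: eq_bigr => y _; ring.
by apply: sumr_ge0 => x _; apply: sumr_ge0 => y _; apply: sqr_ge0.
Qed.

(** Bound |f x f y| by (f x^2 + f y^2) / 2; symmetry of [K] turns column sums into row sums. *)
Lemma Schur_test (F : rcfType) (T : finType) (K : T -> T -> F) (B : F)
    (f : T -> F) :
  (forall x y, K x y = K y x) -> (forall x, \sum_y `|K x y| <= B) ->
  \sum_x \sum_y f x * f y * K x y <= B * \sum_x f x ^+ 2.
Proof.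
move=> KC KB.
have h : \sum_x \sum_y f x * f y * K x y
    <= \sum_x \sum_y (f x ^+ 2 * `|K x y| / 2 + f y ^+ 2 * `|K x y| / 2).
  apply: ler_sum => x _; apply: ler_sum => y _.
  have := ler_norm (f x * f y * K x y); move/le_trans; apply.
  rewrite -!mulrDl normrM mulrAC ler_wpM2r // normrM ler_pdivlMr //.
  rewrite -[f x ^+ 2]real_normK ?num_real // -[f y ^+ 2]real_normK ?num_real //.
  by have := sqr_ge0 (`|f x| - `|f y|); nra.
apply: le_trans h _.
under eq_bigr do rewrite big_split.
rewrite big_split /= [X in _ + X]exchange_big /=.
rewrite -big_split mulr_sumr; apply: ler_sum => x _ /=.
have -> : \sum_i f x ^+ 2 * `|K i x| / 2 = \sum_i f x ^+ 2 * `|K x i| / 2.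
  by apply: eq_bigr => i _; rewrite KC.
rewrite -mulr_suml -mulr_sumr.
have := ler_wpM2l (sqr_ge0 (f x)) (KB x); lra.
Qed.

(** * Operator norm of the centred incidence matrix *)

Section Spectral.
Variables (F : rcfType) (A : finComUnitRingType) (d : nat).
Hypothesis locA : local_ring A.
Let Q : F := #|A|%:R.
Let m : F := #|nonunits A|%:R.
Implicit Types x y u v : 'rV[A]_d.+1.

Definition defect (a : A) x y : F := (dot x y == a)%:R - #|A|%:R^-1.

Definition gram (a : A) x x' : F := \sum_y defect a x y * defect a x' y.

Let Q_gt0 : 0 < Q.
Proof. by rewrite ltr0n; apply/card_gt0P; exists 0. Qed.
Let m_gt0 : 0 < m.
Proof. by rewrite ltr0n nonunits_gt0. Qed.
Let m_le : m <= Q.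
Proof. by rewrite ler_nat nonunits_le. Qed.

Lemma degreeE a x : a \is a GRing.unit ->
  \sum_y (dot x y == a)%:R = (prim x)%:R * Q ^+ d.
Proof.
move=> ua; case px: (prim x); last first.
  rewrite mul0r big1 // => y _; case: eqP => // xy.
  by move: px; rewrite (dot_unit_prim locA (y := y)) ?xy.
rewrite mul1r sum_indicator; apply: (mulIf (lt0r_neq0 Q_gt0)).
by rewrite -exprSr -natrM card_dot // natrX.
Qed.

(** After expanding, the Q^(d+1) constant terms Q^-2 add up to Q^d / Q, and each primitive vector
    subtracts that amount once through its degree. *)
Lemma gramE a x x' : a \is a GRing.unit ->
  gram a x x' = #|[set y | (dot x y == a) && (dot x' y == a)]|%:R
    + (1 - (prim x)%:R - (prim x')%:R) * (Q ^+ d / Q).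
Proof.
move=> ua; rewrite /gram -sum_indicator.
transitivity (\sum_y ((((dot x y == a) && (dot x' y == a))%:R : F)
   - Q^-1 * (dot x y == a)%:R - Q^-1 * (dot x' y == a)%:R + Q^-2)).
  apply: eq_bigr => y _; rewrite /defect -/Q -mulnb natrM.
  by field; exact: lt0r_neq0.
rewrite big_split /= !sumrB -!mulr_sumr !degreeE // sumr_const card_mx mul1n.
rewrite -[_ *+ (_ ^ _)]mulr_natr natrX -/Q (exprS Q d) -!addrA; congr (_ + _).
move: (prim x)%:R (prim x')%:R (Q ^+ d) => r s t.
field; exact: lt0r_neq0.
Qed.

(** For primitive [x] the independent [x'] contribute 0; for the dependent ones the codegrees and
    the at most Q m^d terms Q^d / Q each give Q^d m^d. For nonprimitive [x] only the m^(d+1)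
    nonprimitive [x'] contribute, Q^d / Q each. *)
Lemma sum_gram_le a x : a \is a GRing.unit ->
  \sum_x' `|gram a x x'| <= 2 * Q ^+ d * m ^+ d.
Proof.
move=> ua; have kap0 : 0 <= Q ^+ d / Q by rewrite divr_ge0 ?exprn_ge0 ?ltW.
case px: (prim x).
  have h x' : `|gram a x x'| <= (if dep x x' then
      #|[set y | (dot x y == a) && (dot x' y == a)]|%:R + Q ^+ d / Q else 0).
    rewrite gramE // px; case: ifPn => [_|ndx].
      have : 0 <= #|[set y | (dot x y == a) && (dot x' y == a)]|%:R :> F by [].
      move: kap0; move: #|_|%:R (Q ^+ d / Q) => c k k0 c0.
      rewrite ler_norml; case: prim; rewrite ?mulr1n ?mulr0n;
        by apply/andP; split; lra.
    have -> : prim x'.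
      apply: contraNT ndx => /primPn x'N; apply/forallP => i; apply/forallP => j.
      by rewrite /minor locA // !inE ?unitrN unitrM negb_and x'N ?orbT.
    have := card_dot2 a a ndx; move/(congr1 (fun n => n%:R : F)).
    rewrite natrM !natrX -/Q (exprS Q d) => h.
    have -> : #|[set y | (dot x y == a) && (dot x' y == a)]|%:R = Q ^+ d / Q.
      apply: (mulIf (lt0r_neq0 (exprn_gt0 2 Q_gt0))).
      by rewrite h; move: (Q ^+ d) => t; field; exact: lt0r_neq0.
    by rewrite mulr1n subrr sub0r mulN1r subrr normr0.
  apply: le_trans (ler_sum _ (fun x' _ => h x')) _.
  rewrite -big_mkcond big_split /= -natr_sum sumr_const.
  have h1 := sum_codegree_dep locA ua px.
  have h2 := card_dep locA px.
  rewrite -(ler_nat F) natrM !natrX in h1.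
  rewrite -(ler_nat F) natrM !natrX cardsE in h2.
  have h3 := ler_wpM2l kap0 h2.
  rewrite -mulrA mulr2n mulrDl mul1r lerD // -mulr_natr (le_trans h3) //.
  by rewrite mulrA divfK ?lt0r_neq0.
have h x' : `|gram a x x'| = (~~ prim x')%:R * (Q ^+ d / Q).
  rewrite gramE // px.
  rewrite (_ : [set _ | _] = set0).
    rewrite cards0; case: prim;
      by rewrite /= !subr0 ?subrr ?add0r ?mul1r ?mul0r ?normr0 ?ger0_norm.
  apply/setP => y; rewrite !inE; apply/negP => /andP[/eqP xy _].
  by move: px; rewrite (dot_unit_prim locA (y := y)) ?xy.
under eq_bigr do rewrite h.
rewrite -mulr_suml sum_indicator card_nonprim natrX exprS -/m.
have mQ : m / Q <= 1 by rewrite ler_pdivrMr ?mul1r.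
have md0 : 0 <= m ^+ d * Q ^+ d by rewrite mulr_ge0 // exprn_ge0 // ltW.
have := ler_wpM2l md0 mQ; nra.
Qed.

(** Cauchy-Schwarz over [y] bounds the squared left side by |g|^2 times the quadratic form of [gram]
    at [f], to which the Schur test applies. *)
Lemma defect_op_le a (f g : 'rV[A]_d.+1 -> F) : a \is a GRing.unit ->
  `|\sum_x \sum_y f x * defect a x y * g y|
    <= Num.sqrt (2 * Q ^+ d * m ^+ d) * Num.sqrt (\sum_x f x ^+ 2) *
       Num.sqrt (\sum_x g x ^+ 2).
Proof.
move=> ua; have B0 : 0 <= 2 * Q ^+ d * m ^+ d.
  by rewrite !mulr_ge0 ?exprn_ge0 // ltW.
have S0 (h : 'rV[A]_d.+1 -> F) : 0 <= \sum_x h x ^+ 2.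
  by apply: sumr_ge0 => x _; apply: sqr_ge0.
rewrite -sqrtrM // -sqrtrM; last exact: mulr_ge0.
rewrite -sqrtr_sqr ler_wsqrtr //.
rewrite exchange_big /=; under eq_bigr do rewrite -mulr_suml.
apply: le_trans (sum_sqr_Cauchy _ _) _; rewrite ler_wpM2r //.
apply: le_trans (Schur_test f _ (fun x => sum_gram_le x ua)); last first.
  by move=> x y; apply: eq_bigr => z _; rewrite mulrC.
rewrite le_eqVlt; apply/orP; left; apply/eqP.
under eq_bigr do rewrite expr2 mulr_suml.
rewrite exchange_big; apply: eq_bigr => x _ /=.
under eq_bigr do rewrite mulr_sumr.
rewrite exchange_big; apply: eq_bigr => x' _ /=.
by rewrite mulr_sumr; apply: eq_bigr => y _; ring.
Qed.

End Spectral.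

(** * Sums over lists of points of [E] *)

Section ListSum.
Variables (T : finType) (E : {set T}).

(** Recursion on the first point lets a walk be extended or cut at any position without casts
    between tuple types. *)
Fixpoint lsum (n : nat) (P : seq T -> nat) : nat :=
  if n is n'.+1 then (\sum_(x in E) lsum n' (fun xs => P (x :: xs)))%N
  else P [::].

Lemma leq_lsum n (P P' : seq T -> nat) :
  (forall xs, size xs = n -> P xs <= P' xs)%N -> (lsum n P <= lsum n P')%N.
Proof.
elim: n P P' => [|n IH] P P' h /=; first exact: h.
by apply: leq_sum => x _; apply: IH => xs sz; apply: h; rewrite /= sz.
Qed.

Lemma eq_lsum n (P P' : seq T -> nat) :
  (forall xs, size xs = n -> P xs = P' xs) -> lsum n P = lsum n P'.
Proof.
by move=> h; apply/eqP; rewrite eqn_leq !leq_lsum // => xs /h ->.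
Qed.

Lemma lsumD n P P' :
  lsum n (fun xs => P xs + P' xs)%N = (lsum n P + lsum n P')%N.
Proof.
elim: n P P' => [|n IH] P P' //=.
by rewrite -big_split; apply: eq_bigr => x _; rewrite IH.
Qed.

Lemma lsumMl n c P : lsum n (fun xs => c * P xs)%N = (c * lsum n P)%N.
Proof.
elim: n P => [|n IH] P //=.
by rewrite big_distrr; apply: eq_bigr => x _; rewrite IH.
Qed.

Lemma lsum_sum n (r : seq nat) (P : nat -> seq T -> nat) :
  lsum n (fun xs => \sum_(j <- r) P j xs)%N = (\sum_(j <- r) lsum n (P j))%N.
Proof.
elim: r => [|j r IH].
  rewrite big_nil -[RHS](mul0n (lsum n (fun=> 0%N))) -lsumMl.
  by apply: eq_lsum => xs _; rewrite big_nil.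
rewrite big_cons -IH -lsumD.
by apply: eq_lsum => xs _; rewrite big_cons.
Qed.

Lemma lsum_cat m n P :
  lsum (m + n) P = lsum m (fun l => lsum n (fun r => P (l ++ r))).
Proof.
elim: m P => [|m IH] P //=.
by apply: eq_bigr => x _; rewrite IH.
Qed.

Lemma sum_tuple_lsum n (P : seq T -> nat) :
  (\sum_(t : n.-tuple T | all (mem E) t) P t)%N = lsum n P.
Proof.
elim: n P => [|n IH] P /=.
  by rewrite (big_pred1 [tuple]) // => t; rewrite tuple0 /= eqxx.
under [RHS]eq_bigr => x _ do rewrite -IH.
rewrite pair_big_dep /=.
rewrite (reindex (fun xt : T * n.-tuple T => [tuple of xt.1 :: xt.2])) //=.
exists (fun t => (thead t, [tuple of behead t])) => [[x t] _|t _] /=.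
  by congr (_, _); apply: val_inj.
by rewrite [t]tuple_eta; apply: val_inj.
Qed.

Lemma sum_mem_seq (l : seq T) : (\sum_(z in E) (z \in l) <= size l)%N.
Proof.
rewrite (leq_trans _ (card_size l)) // -sum1_card.
rewrite [leqRHS]big_mkcond [leqLHS]big_mkcond /=.
by apply: leq_sum => z _; case: (z \in E); case: (z \in l).
Qed.

End ListSum.

(** * Walks in [E] and their repeated points *)

Section Walk.
Variables (A : finComUnitRingType) (d : nat) (E : {set 'rV[A]_d}).
Implicit Types (s : seq A) (xs : seq 'rV[A]_d).

Definition walk s xs :=
  all (fun j => dot (nth 0 xs j) (nth 0 xs j.+1) == nth 0 s j) (iota 0 (size s)).

Definition nwalks s := lsum E (size s).+1 (fun xs => walk s xs).

Definition nwalks_from s x := lsum E (size s) (fun xs => walk s (x :: xs)).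

Definition nrevisits s j :=
  lsum E (size s).+1 (fun xs => walk s xs && (nth 0 xs j \in take j xs)).

Lemma walkP s xs : reflect
  (forall j, (j < size s)%N -> dot (nth 0 xs j) (nth 0 xs j.+1) = nth 0 s j)
  (walk s xs).
Proof.
apply: (iffP allP) => [h j js|h j]; last by rewrite mem_iota => /h ->.
by apply/eqP/h; rewrite mem_iota.
Qed.

Lemma walk_cons a s x y xs :
  walk (a :: s) [:: x, y & xs] = (dot x y == a) && walk s (y :: xs).
Proof. by rewrite /walk /= (iotaDl 1 0) all_map. Qed.

Lemma nwalksE s : nwalks s = (\sum_(x in E) nwalks_from s x)%N.
Proof. by []. Qed.

(** One application of the adjacency matrix restricted to [E]: counting walks becomes iterating
    operators. *)
Lemma nwalks_from_cons a s x :
  nwalks_from (a :: s) x = (\sum_(y in E) (dot x y == a) * nwalks_from s y)%N.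
Proof.
apply: eq_bigr => y _; rewrite -lsumMl; apply: eq_lsum => xs _.
by rewrite walk_cons mulnb.
Qed.

Lemma nrevisits0 s : nrevisits s 0 = 0%N.
Proof.
rewrite -[RHS](mul0n (nwalks s)) -lsumMl; apply: eq_lsum => xs _.
by rewrite take0 andbF.
Qed.

(** The starting point is determined by the next one, so only the first edge is lost. *)
Lemma nrevisits1 s : (0 < size s)%N -> (nrevisits s 1 <= nwalks (behead s))%N.
Proof.
case: s => // a s _; rewrite /nrevisits /nwalks /= exchange_big /=.
apply: leq_sum => z _.
have -> : lsum E (size s) (fun xs => walk s (z :: xs)) =
   (lsum E (size s) (fun xs => walk s (z :: xs)) * 1)%N by rewrite muln1.
apply: leq_trans (leq_mul (leqnn _) (sum_mem_seq E [:: z])).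
rewrite big_distrr; apply: leq_sum => x _ /=.
rewrite mulnC -lsumMl; apply: leq_lsum => xs _; rewrite walk_cons /= !inE.
by rewrite [z == x]eq_sym; case: (x == z); case: (dot x z == a); case: walk.
Qed.

(* Both edges at position j are dropped; the point there is one of the j
   earlier ones. *)
Lemma nrevisits_le s j : (0 < j <= size s)%N ->
  (nrevisits s j <= j * nwalks (take j.-1 s) *
     lsum E (size s - j) (fun r => walk (drop j.+1 s) r))%N.
Proof.
case/andP=> j0 js; rewrite /nrevisits.
have -> : (size s).+1 = (j + (size s - j).+1)%N by lia.
rewrite lsum_cat /nwalks size_takel ?(leq_trans (leq_pred _)) // prednK //.
rewrite [(j * _)%N]mulnC -mulnA mulnC -lsumMl; apply: leq_lsum => l lj /=.
set N := lsum E (size s - j) _.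
apply: (@leq_trans (\sum_(z in E) (z \in l) * (N * walk (take j.-1 s) l))).
  apply: leq_sum => z _; rewrite mulnCA mulnC /N -lsumMl.
  apply: leq_lsum => r rj.
  case: (boolP (walk s _)) => //= /walkP w.
  rewrite take_cat nth_cat lj ltnn subnn take0 cats0 /=.
  have -> : walk (take j.-1 s) l.
    apply/walkP => i; rewrite size_takel ?(leq_trans (leq_pred _)) // => ij.
    by rewrite nth_take // -w ?nth_cat ?lj ?ifT //; lia.
  have -> : walk (drop j.+1 s) r; last by rewrite !muln1.
  apply/walkP => i; rewrite size_drop nth_drop => ij.
  rewrite -w ?nth_cat ?lj; last lia.
  rewrite !ifF; try lia.
  have -> : (j.+1 + i - j = i.+1)%N by lia.
  by have -> : ((j.+1 + i).+1 - j = i.+2)%N by lia.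
by rewrite -big_distrl /= -mulnA leq_mul // -lj sum_mem_seq.
Qed.

(** Equal points at i < j make [j] a revisit; a union bound over [j] follows. *)
Lemma nwalks_nonuniq_le s :
  (lsum E (size s).+1 (fun xs => walk s xs && ~~ uniq xs) <=
     \sum_(0 <= j < (size s).+1) nrevisits s j)%N.
Proof.
rewrite -lsum_sum; apply: leq_lsum => xs sz.
case: (walk s xs) => //=; case: (boolP (uniq xs)) => //= /(uniqPn 0).
case=> [i [j [ij jxs e]]].
rewrite (big_rem j) /=; last by rewrite mem_index_iota -sz.
have -> : nth 0 xs j \in take j xs; last by [].
by rewrite -e -(nth_take 0 ij) mem_nth // size_takel // ltnW.
Qed.

End Walk.

(** * Asymptotic number of walks *)

Section WalkCount.
Variables (F : rcfType) (A : finComUnitRingType) (d : nat).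
Variable (E : {set 'rV[A]_d.+1}).
Hypothesis locA : local_ring A.
Let Q : F := #|A|%:R.
Let n : F := #|E|%:R.
Let L : F := Num.sqrt (2 * Q ^+ d * #|nonunits A|%:R ^+ d).
(** Bounds the norm of the adjacency operator on [E]: the constant matrix 1/Q has norm n / Q there,
    and M has norm at most [L]. *)
Let c : F := n / Q + L.
Let g s x : F := (x \in E)%:R * (nwalks_from E s x)%:R.
Let S s : F := \sum_x g s x ^+ 2.

Let Q_gt0 : 0 < Q.
Proof. by rewrite ltr0n; apply/card_gt0P; exists 0. Qed.

Let c_ge0 : 0 <= c.
Proof. by rewrite addr_ge0 ?sqrtr_ge0 // divr_ge0 // ltW. Qed.

Let S_ge0 s : 0 <= S s.
Proof. by apply: sumr_ge0 => x _; apply: sqr_ge0. Qed.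

Let sum_g s : \sum_x g s x = (nwalks E s)%:R.
Proof.
rewrite nwalksE natr_sum [RHS]big_mkcond; apply: eq_bigr => x _.
by rewrite /g; case: (x \in E); rewrite ?mul1r ?mul0r.
Qed.

Let sum_mem1 : \sum_x (x \in E)%:R = n.
Proof. by rewrite sum_indicator cardsE. Qed.

Let sum_mem2 : \sum_x ((x \in E)%:R : F) ^+ 2 = n.
Proof.
rewrite -sum_mem1; apply: eq_bigr => x _.
by case: (x \in E); rewrite ?expr1n ?expr0n.
Qed.

(** An edge indicator is [defect] plus 1/Q, and the constant part sees [g s] only through its
    total. *)
Let g_cons a s x :
  g (a :: s) x =
    \sum_y (x \in E)%:R * defect F a x y * g s y
    + (x \in E)%:R * (nwalks E s)%:R / Q.
Proof.
rewrite -sum_g mulr_sumr mulr_suml -big_split /= {1}/g nwalks_from_cons natr_sum.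
rewrite mulr_sumr big_mkcond; apply: eq_bigr => y _.
rewrite /g /defect -/Q natrM; case: (y \in E) => /=; ring.
Qed.

Let mem_g s x : (x \in E)%:R * g s x = g s x.
Proof. by rewrite mulrA -natrM mulnb andbb. Qed.

Let nwalks_norm s : (nwalks E s)%:R <= Num.sqrt n * Num.sqrt (S s).
Proof.
rewrite -sum_g -sqrtrM // -[leLHS]ger0_norm; last first.
  by apply: sumr_ge0 => x _; apply: mulr_ge0.
rewrite -sqrtr_sqr ler_wsqrtr //; under eq_bigr do rewrite -mem_g.
by rewrite -sum_mem2 sum_sqr_Cauchy.
Qed.

(** Expand one factor of the square by [g_cons], bound the two parts by the operator norm and by
    Cauchy-Schwarz, then cancel the norm of [g (a :: s)]. *)
Let norm_cons a s : a \is a GRing.unit ->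
  Num.sqrt (S (a :: s)) <= c * Num.sqrt (S s).
Proof.
move=> ua; have [u0|uN] := eqVneq (Num.sqrt (S (a :: s))) 0.
  by rewrite u0 mulr_ge0 ?sqrtr_ge0.
have u_gt0 : 0 < Num.sqrt (S (a :: s)) by rewrite lt0r uN sqrtr_ge0.
rewrite -(ler_pM2l u_gt0) -expr2 sqr_sqrtr //.
rewrite [leLHS](_ : S (a :: s) =
  \sum_x \sum_y g (a :: s) x * defect F a x y * g s y +
  (nwalks E (a :: s))%:R * (nwalks E s)%:R / Q); last first.
  rewrite -[in RHS]sum_g !mulr_suml -big_split; apply: eq_bigr => x _ /=.
  rewrite expr2 {2}g_cons mulrDr; congr (_ + _).
    rewrite mulr_sumr; apply: eq_bigr => y _.
    by rewrite -[in RHS](mem_g (a :: s)); ring.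
  by rewrite -[in RHS](mem_g (a :: s)); ring.
apply: (@le_trans _ _ (L * Num.sqrt (S (a :: s)) * Num.sqrt (S s)
   + (Num.sqrt n * Num.sqrt (S (a :: s))) * (Num.sqrt n * Num.sqrt (S s)) / Q)).
  apply: lerD; first by apply: le_trans (ler_norm _) (defect_op_le locA _ _ ua).
  by rewrite ler_wpM2r ?invr_ge0 ?(ltW Q_gt0) // ler_pM.
have nn : Num.sqrt n * Num.sqrt n = n by rewrite -expr2 sqr_sqrtr.
rewrite mulrACA nn /c le_eqVlt; apply/orP; left; apply/eqP; ring.
Qed.

Let norm_le s : {in s, forall a, a \is a GRing.unit} ->
  Num.sqrt (S s) <= Num.sqrt n * c ^+ size s.
Proof.
elim: s => [|a s IH] us.
  rewrite mulr1 ler_wsqrtr // -sum_mem2; apply: ler_sum => x _.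
  by rewrite /g /= mulr1.
apply: le_trans (norm_cons s (us a (mem_head _ _))) _.
rewrite /= exprS mulrCA ler_wpM2l // IH // => b bs; apply: us.
by rewrite inE bs orbT.
Qed.

Lemma nwalks_le s : {in s, forall a, a \is a GRing.unit} ->
  (nwalks E s)%:R <= n * c ^+ size s.
Proof.
move=> us; apply: le_trans (nwalks_norm s) _.
have nn : Num.sqrt n * Num.sqrt n = n by rewrite -expr2 sqr_sqrtr.
by rewrite -{2}nn -mulrA ler_wpM2l ?sqrtr_ge0 // norm_le.
Qed.

(** Each step multiplies the total by n / Q up to an error L n c^i, i being the number of edges
    already counted; since c - n / Q = L, the errors telescope. *)
Lemma nwalks_asymp s : {in s, forall a, a \is a GRing.unit} ->
  `|(nwalks E s)%:R - n * (n / Q) ^+ size s|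
     <= n * (c ^+ size s - (n / Q) ^+ size s).
Proof.
elim: s => [|a s IH] us.
  have -> : nwalks E [::] = #|E| by rewrite /nwalks /= sum1_card.
  by rewrite !expr0 mulr1 !subrr normr0 mulr0.
have us' : {in s, forall b, b \is a GRing.unit}.
  by move=> b bs; apply: us; rewrite inE bs orbT.
have ua := us a (mem_head _ _).
have nn : Num.sqrt n * Num.sqrt n = n by rewrite -expr2 sqr_sqrtr.
have -> : (nwalks E (a :: s))%:R =
    \sum_x \sum_y (x \in E)%:R * defect F a x y * g s y
    + n / Q * (nwalks E s)%:R.
  rewrite -sum_g; under eq_bigr do rewrite g_cons; rewrite big_split /=.
  by congr (_ + _); rewrite -!mulr_suml sum_mem1 mulrAC.
rewrite /= !exprS.
have -> : forall X, X + n / Q * (nwalks E s)%:R - n * (n / Q * (n / Q) ^+ size s)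
   = X + n / Q * ((nwalks E s)%:R - n * (n / Q) ^+ size s).
  by move=> X; ring.
have -> : n * (c * c ^+ size s - n / Q * (n / Q) ^+ size s) =
  L * n * c ^+ size s + n / Q * (n * (c ^+ size s - (n / Q) ^+ size s)).
  by rewrite {1}/c; ring.
apply: le_trans (ler_normD _ _) _; apply: lerD; last first.
  rewrite normrM ger0_norm ?divr_ge0 ?(ltW Q_gt0) //.
  by rewrite ler_wpM2l ?divr_ge0 ?(ltW Q_gt0) // IH.
apply: le_trans (defect_op_le locA _ _ ua) _.
rewrite sum_mem2 -{2}nn -/L -!mulrA ler_wpM2l ?sqrtr_ge0 //.
by rewrite ler_wpM2l ?sqrtr_ge0 // norm_le.
Qed.

End WalkCount.

(** The chord bound for a convex function on [0, 1]; it makes the error linear in [t]. *)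
Lemma expr1D_sub1_le (F : realFieldType) (t : F) k : 0 <= t <= 1 ->
  (1 + t) ^+ k - 1 <= t * (2 ^+ k - 1).
Proof.
case/andP=> t0 t1; elim: k => [|k IH]; first by rewrite !expr0 !subrr mulr0.
have two1 : 1 <= 2 ^+ k :> F by apply: exprn_ege1; rewrite ler1n.
rewrite !exprS; move: IH two1; move: (_ ^+ k) (2 ^+ k) => X Y IH Y1.
have : t * X <= t * (t * (Y - 1) + 1) by apply: ler_wpM2l => //; lra.
have : t * (t * (Y - 1)) <= t * (Y - 1) by rewrite ler_piMl // mulr_ge0 // subr_ge0.
nra.
Qed.

(** * From walks to walks with distinct points *)

Section ChainCount.
Variables (F : rcfType) (A : finComUnitRingType) (d : nat).
Variable (E : {set 'rV[A]_d.+1}).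
Hypothesis locA : local_ring A.
Let Q : F := #|A|%:R.
Let n : F := #|E|%:R.
Let L : F := Num.sqrt (2 * Q ^+ d * #|nonunits A|%:R ^+ d).
Let M : F := n / Q.
(** [t] controls every relative error: [LM] the spectral one, [Qn] the loss of one edge, [QQn] the
    loss of two. *)
Variables (t : F) (s : seq A).
Hypotheses (us : {in s, forall a, a \is a GRing.unit}) (s2 : (2 <= size s)%N).
Hypotheses (t1 : t <= 1) (n_gt0 : 0 < n) (LM : L <= t * M) (Qn : Q <= t * n)
  (QQn : (3 <= size s)%N -> Q ^+ 2 <= t * n).

Let Q_gt0 : 0 < Q.
Proof. by rewrite ltr0n; apply/card_gt0P; exists 0. Qed.

Let M_gt0 : 0 < M.
Proof. exact: divr_gt0. Qed.

Let t_ge0 : 0 <= t.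
Proof. by rewrite -(pmulr_lge0 _ n_gt0) (le_trans _ Qn) // ltW. Qed.

Let nwalks_le2 s' : {in s', forall a, a \is a GRing.unit} ->
  (nwalks E s')%:R <= n * (2 * M) ^+ size s'.
Proof.
move=> us'; apply: le_trans (nwalks_le F E locA us') _.
rewrite ler_wpM2l // lerXn2r ?nnegrE ?mulr_ge0 ?addr_ge0 ?sqrtr_ge0 ?(ltW M_gt0) //.
  by rewrite invr_ge0 ltW.
rewrite -/Q -/n -/M -/L [leRHS]mulr_natl mulr2n lerD2l (le_trans LM) //.
by rewrite ler_piMl // ltW.
Qed.

Let path_bound : n * (2 * M) ^+ (size s).-1 <= 2 ^+ size s * t * (n * M ^+ size s).
Proof.
case: (size s) s2 => // k _ /=; rewrite exprMn !exprS.
have h : 1 <= 2 * (t * M).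
  have -> : 2 * (t * M) = 2 * (t * n) / Q by rewrite /M !mulrA.
  rewrite ler_pdivlMr // mul1r (le_trans Qn) //.
  by rewrite ler_peMl ?ler1n // mulr_ge0 // ltW.
have P0 : 0 <= n * (2 ^+ k * M ^+ k).
  by rewrite !mulr_ge0 // exprn_ge0 // ltW.
by have := ler_wpM2l P0 h; rewrite mulr1; nra.
Qed.

Let split_bound : (3 <= size s)%N ->
  n ^+ 2 * (2 * M) ^+ (size s).-2 <= 2 ^+ size s * t * (n * M ^+ size s).
Proof.
move=> s3; have QQ := QQn s3; case: (size s) s3 => [//|[//|k]] _ /=.
rewrite exprMn !exprS.
have h : n <= 4 * (t * (M * M)).
  have -> : 4 * (t * (M * M)) = n * (4 * (t * n)) / Q ^+ 2.
    by rewrite /M; field; exact: lt0r_neq0.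
  rewrite ler_pdivlMr ?exprn_gt0 // ler_wpM2l // (le_trans QQ) //.
  by rewrite ler_peMl ?ler1n // mulr_ge0 // ltW.
  have P0 : 0 <= n * (2 ^+ k * M ^+ k).
  by rewrite !mulr_ge0 // exprn_ge0 // ltW.
have := ler_wpM2l P0 h; nra.
Qed.

Let nrevisits_bound j : (j < (size s).+1)%N ->
  (nrevisits E s j)%:R <= (size s)%:R * (2 ^+ size s * t * (n * M ^+ size s)).
Proof.
have X0 : 0 <= 2 ^+ size s * t * (n * M ^+ size s).
  by rewrite !mulr_ge0 // ?exprn_ge0 // ltW.
have us_take i : {in take i s, forall a, a \is a GRing.unit}.
  by move=> a /mem_take; apply: us.
have us_drop i : {in drop i s, forall a, a \is a GRing.unit}.
  by move=> a /mem_drop; apply: us.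
case: j => [|j]; first by rewrite nrevisits0 mulr_ge0.
rewrite ltnS => js.
have s_gt0 : (0 < size s)%N by apply: leq_trans s2.
have h := nrevisits_le E (s := s) (j := j.+1) js.
rewrite -(ler_nat F) !natrM in h.
have jsF : j.+1%:R <= (size s)%:R :> F by rewrite ler_nat.
(* At the last position no edge leaves the repeated point, so only one edge is lost. *)
move: js; rewrite leq_eqVlt => /orP[/eqP js|js].
  apply: le_trans h _; rewrite -js subnn /= drop_oversize ?js // mulr1.
  rewrite ler_wpM2l // -js (le_trans (nwalks_le2 (us_take _))) //.
  rewrite size_takel; last by rewrite -js leqnSn.
  by have := path_bound; rewrite -js.
have [s3|s3] := leqP 3 (size s).
  apply: le_trans h _; rewrite -mulrA ler_pM ?mulr_ge0 //.
  apply: le_trans (split_bound s3).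
  rewrite -(subnSK js).
  have := nwalks_le2 (us_drop j.+2); rewrite /nwalks size_drop => h1.
  have h2 := nwalks_le2 (us_take j); rewrite (@size_takel j) in h2; first last.
    by apply: ltnW; apply: ltnW.
  have -> : (size s).-2 = (j + (size s - j.+2))%N by rewrite -{1}(subnKC js).
  apply: le_trans (ler_pM _ _ h2 h1) _ => //.
  by rewrite exprD expr2 mulrACA.
(* What remains is the middle point of a walk with two edges, where [nrevisits1] loses only one. *)
have j0 : j = 0%N by case: (j) (leq_trans js s3).
have := nrevisits1 E s_gt0; rewrite -(ler_nat F) j0 => /le_trans; apply.
have us_behead : {in behead s, forall a, a \is a GRing.unit}.
  by move=> a /mem_behead; apply: us.
apply: le_trans (nwalks_le2 us_behead) _; rewrite size_behead.
by apply: le_trans path_bound _; rewrite ler_peMl // ler1n.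
Qed.

(** In the constant, 2^k comes from the walk asymptotics and the product (k+1) k 2^k from k + 1
    positions of revisit, with k the length of [s]. *)
Lemma paths_asymp :
  `|(lsum E (size s).+1 (fun xs => walk s xs && uniq xs))%:R - n * M ^+ size s|
    <= t * (2 ^+ size s * (1 + (size s).+1%:R * (size s)%:R)) * (n * M ^+ size s).
Proof.
have Mk0 : 0 < M ^+ size s by rewrite exprn_gt0.
have c_bound : n * ((M + L) ^+ size s - M ^+ size s) <=
    t * 2 ^+ size s * (n * M ^+ size s).
  have h1 : (M + L) ^+ size s <= ((1 + t) * M) ^+ size s.
    rewrite lerXn2r ?nnegrE ?mulr_ge0 ?addr_ge0 ?sqrtr_ge0 ?invr_ge0
      ?(ltW M_gt0) ?(ltW Q_gt0) //.
    by rewrite mulrDl mul1r lerD2l.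
  rewrite exprMn in h1; rewrite mulrCA ler_wpM2l //.
  have : (1 + t) ^+ size s - 1 <= t * (2 ^+ size s - 1).
    by apply: expr1D_sub1_le; rewrite t_ge0.
  move/(ler_wpM2r (ltW Mk0)); have := mulr_ge0 t_ge0 (ltW Mk0); lra.
have split : nwalks E s =
    (lsum E (size s).+1 (fun xs => walk s xs && uniq xs) +
     lsum E (size s).+1 (fun xs => walk s xs && ~~ uniq xs))%N.
  rewrite -lsumD; apply: eq_lsum => xs _.
  by case: (walk s xs); case: (uniq xs).
have bad : (lsum E (size s).+1 (fun xs => walk s xs && ~~ uniq xs))%:R <=
    (size s).+1%:R * ((size s)%:R * (2 ^+ size s * t * (n * M ^+ size s))).
  apply: (@le_trans _ _ (\sum_(0 <= j < (size s).+1) (nrevisits E s j)%:R)).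
    by rewrite -natr_sum ler_nat nwalks_nonuniq_le.
  rewrite -[X in X%:R * _](subn0 (size s).+1) mulr_natl -sumr_const_nat.
  by apply: ler_sum_nat => j /nrevisits_bound.
have main := nwalks_asymp F E locA us.
rewrite -/n -/Q -/M -/L split natrD in main.
set g := (lsum _ _ (fun xs => _ && uniq xs))%:R in main *.
set b := (lsum _ _ _)%:R in main bad.
have -> : g - n * M ^+ size s = (g + b - n * M ^+ size s) - b by ring.
apply: le_trans (ler_normB _ _) _; rewrite [`|b|]ger0_norm //.
have := le_trans main c_bound; lra.
Qed.

End ChainCount.

(** * The local ring of integers modulo a prime power *)

Section PrimePower.
Variables (p l : nat).
Hypotheses (p_pr : prime p) (l_gt0 : (0 < l)%N).

Let q_gt1 : (1 < p ^ l)%N.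
Proof. by rewrite -(exp1n l) ltn_exp2r // prime_gt1. Qed.

Lemma card_Zpl : #|'Z_(p ^ l)| = (p ^ l)%N.
Proof. by rewrite card_ord Zp_cast. Qed.

Lemma unit_natZpl a : ((a%:R : 'Z_(p ^ l)) \is a GRing.unit) = ~~ (p %| a)%N.
Proof. by rewrite unitZpE // coprime_pexpl // prime_coprime. Qed.

Lemma local_Zpl : local_ring 'Z_(p ^ l).
Proof.
move=> a b; rewrite !inE -[a]natr_Zp -[b]natr_Zp -natrD !unit_natZpl !negbK.
exact: dvdn_add.
Qed.

Lemma card_nonunits_Zpl : (#|nonunits 'Z_(p ^ l)| * p = p ^ l)%N.
Proof.
have cU : #|[set a : 'Z_(p ^ l) | a \is a GRing.unit]| = totient (p ^ l).
  rewrite totient_count_coprime -[X in index_iota 0 X](Zp_cast q_gt1) big_mkord.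
  rewrite -sum1_card big_mkcond; apply: eq_bigr => a _.
  by rewrite inE -[a in LHS]natr_Zp unitZpE //; case: coprime.
have := cardsC [set a : 'Z_(p ^ l) | a \is a GRing.unit].
have -> : ~: [set a : 'Z_(p ^ l) | a \is a GRing.unit] = nonunits 'Z_(p ^ l).
  by apply/setP => a; rewrite !inE.
rewrite cU card_Zpl totient_pfactor //; move: #|nonunits _| => a.
have -> : (p ^ l = p * p ^ l.-1)%N by rewrite -expnS prednK.
have := prime_gt0 p_pr; move: (p ^ l.-1)%N; case: (p) => // r b _ /=.
by rewrite mulSn addnC => /addIn ->; rewrite mulnC mulSn.
Qed.

End PrimePower.

(** * Chains as walks, and the choice of parameters *)

Lemma dot_chainE q d k (alpha : k.-tuple 'Z_q) (x : k.+1.-tuple 'rV['Z_q]_d) :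
  dot_chain alpha x = walk alpha x && uniq x.
Proof.
rewrite /dot_chain andbC; congr (_ && _).
apply/forallP/walkP => [h j|h j].
  rewrite size_tuple => jk; have /eqP := h (Ordinal jk).
  by rewrite !(tnth_nth 0) /= => <-.
by have := h j; rewrite size_tuple !(tnth_nth 0) => /(_ (ltn_ord j)) <-.
Qed.

Lemma card_dot_chains q d k (alpha : k.-tuple 'Z_q) (E : {set 'rV['Z_q]_d}) :
  #|dot_chains alpha E| =
    lsum E (size alpha).+1 (fun xs => walk alpha xs && uniq xs).
Proof.
rewrite size_tuple -sum_tuple_lsum -sum1_card big_mkcond [RHS]big_mkcond.
apply: eq_bigr => x _; rewrite inE dot_chainE.
have -> : [forall j, tnth x j \in E] = all (mem E) x.
  apply/forallP/allP => [h y /tnthP[i ->]|h j]; first exact: h.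
  exact/h/mem_tnth.
by case: (walk _ _); case: (uniq _); case: all.
Qed.

Theorem theorem1p3 (R : realType) (d k : nat) (eps C : R)
    (hd : (1 <= d)%N) (hk : (2 <= k)%N) (heps : 0 < eps) (hC : 0 < C) :
  forall delta : R, 0 < delta ->
  exists N : nat,
  forall (p l : nat), prime p -> odd p -> (1 <= l)%N -> (N <= p ^ l)%N ->
  forall (E : {set 'rV['Z_(p ^ l)]_d}) (alpha : k.-tuple 'Z_(p ^ l)),
    (forall j : 'I_k, tnth alpha j \is a GRing.unit) ->
    C * (p ^ l)%:R `^ eps *
      (p ^ l)%:R `^ ((d%:R * (2 * l%:R - 1) + 1) / (2 * l%:R) + (k%:R - 2) / 2)
      <= #|E|%:R ->
    `| #|dot_chains alpha E|%:R - #|E|%:R ^+ k.+1 / (p ^ l)%:R ^+ k |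
      <= delta * (#|E|%:R ^+ k.+1 / (p ^ l)%:R ^+ k).
Proof.
move=> delta delta_gt0.
(* [K] is the constant of [paths_asymp]; once Y >= Y0, the choice t = 2 / Y gives t <= 1 and t K <=
   delta. *)
pose K : R := 2 ^+ k * (1 + k.+1%:R * k%:R).
have K_ge0 : 0 <= K by rewrite mulr_ge0 ?exprn_ge0 // addr_ge0 // mulr_ge0.
pose Y0 : R := 2 + 2 * K / delta.
have Kd : 0 <= K / delta by rewrite divr_ge0 // ltW.
have Y0_gt0 : 0 < Y0 by rewrite /Y0; lra.
(* Beyond this bound C q^eps >= Y0. *)
exists (Num.bound ((Y0 / C) `^ eps^-1)) => p l p_pr _ l_gt0 Nq E alpha ua hE.
(* From here on [d] is the rank minus one. *)
case: d hd E hE => // d _ E hE.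
have locA := local_Zpl p_pr l_gt0.
set q : R := (p ^ l)%:R in hE *; set n : R := #|E|%:R in hE *.
have p_gt0 : 0 < p%:R :> R by rewrite ltr0n prime_gt0.
have q_gt0 : 0 < q by rewrite ltr0n expn_gt0 prime_gt0.
have q_ge1 : 1 <= q by rewrite -[1]/(1%:R) ler_nat expn_gt0 prime_gt0.
have pq : p%:R <= q.
  by rewrite ler_nat -[X in (X <= _)%N]expn1 leq_pexp2l // prime_gt0.
have cardA : #|'Z_(p ^ l)|%:R = q by rewrite card_Zpl.
pose Y : R := C * q `^ eps.
have YY0 : Y0 <= Y.
  rewrite /Y -ler_pdivrMl // mulrC.
  have Z0 : 0 <= Y0 / C by rewrite divr_ge0 // ltW.
  rewrite -[leLHS]powRr1 // -(mulVf (lt0r_neq0 heps)) powRrM.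
  rewrite ge0_ler_powR ?nnegrE ?powR_ge0 ?(ltW heps) ?(ltW q_gt0) //.
  apply: le_trans (ltW (archi_boundP (powR_ge0 _ _))) _.
  by rewrite ler_nat.
have Y_ge2 : 2 <= Y by apply: le_trans YY0; rewrite /Y0; lra.
have Y_gt0 : 0 < Y by apply: lt_le_trans YY0.
(* As q^(1/l) = p, squaring the hypothesis leaves integral powers of q and p. *)
have size_sqr : Y ^+ 2 * q ^+ (2 * d + k) <= n ^+ 2 * p%:R ^+ d.
  set e := (X in _ * _ `^ X) in hE.
  have qp : q = p%:R `^ l%:R by rewrite powR_mulrn ?(ltW p_gt0) // /q natrX.
  have eE : (q `^ e) ^+ 2 * p%:R ^+ d = q ^+ (2 * d + k).
    rewrite -!powR_mulrn ?powR_ge0 ?(ltW p_gt0) ?(ltW q_gt0) // qp -!powRrM.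
    rewrite -powRD; last by rewrite (gt_eqF p_gt0) implybT.
    congr (_ `^ _); rewrite /e (natrD _ (2 * d)) (natrM _ 2) -natr1; field.
    by rewrite pnatr_eq0 -lt0n.
  rewrite -eE mulrA -exprMn ler_wpM2r ?exprn_ge0 ?(ltW p_gt0) //.
  by rewrite lerXn2r ?nnegrE ?mulr_ge0 ?powR_ge0 ?(ltW hC).
(* Since p <= q, trading p^d for q^d in [size_sqr] leaves n^2 >= Y^2 q^(d+k). *)
have n_ge i : (2 * i <= d + k)%N -> Y * q ^+ i <= n.
  have Yq_ge0 : 0 <= Y * q ^+ i by rewrite pmulr_rge0 // exprn_ge0 // ltW.
  move=> ik; rewrite -(ler_pXn2r (n := 2)) ?nnegrE //.
  rewrite -(ler_pM2r (exprn_gt0 d p_gt0)); apply: le_trans size_sqr.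
  rewrite exprMn -mulrA ler_wpM2l ?sqr_ge0 //.
  apply: (@le_trans _ _ (q ^+ (d + k) * q ^+ d)).
    rewrite ler_pM ?exprn_ge0 ?(ltW p_gt0) ?(ltW q_gt0) //.
      by rewrite -exprM mulnC ler_weXn2l.
    by rewrite lerXn2r ?nnegrE ?(ltW p_gt0) ?(ltW q_gt0).
  by rewrite -exprD mul2n -addnn addnAC.
have n_gt0 : 0 < n.
  by apply: lt_le_trans (n_ge 0%N isT); rewrite mulr1.
(* In rank one, |E| <= q contradicts n >= Y q with Y >= 2. *)
have d_gt0 : (0 < d)%N.
  have nq : n <= q ^+ d.+1.
    by rewrite -cardA -natrX ler_nat (leq_trans (max_card _)) // card_mx mul1n.
  rewrite lt0n; apply: contraTN Y_ge2 => /eqP d0; rewrite -ltNge.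
  have := n_ge 1%N; rewrite d0 => /(_ hk) /le_trans/(_ nq).
  rewrite d0 expr1 -[leRHS]mul1r ler_pM2r // => /le_lt_trans -> //.
  by rewrite ltr1n.
(* The numerator gives (t Y)^2 = 4, which absorbs the 2 under the square root in [LM]. *)
pose t := 2 / Y.
have tY : t * Y = 2 by rewrite divfK ?lt0r_neq0.
have t_gt0 : 0 < t by rewrite divr_gt0.
have t1 : t <= 1 by rewrite ler_pdivrMr // mul1r.
have Yn i : (2 * i <= d + k)%N -> q ^+ i <= t * n.
  move=> /n_ge /(ler_wpM2l (ltW t_gt0)); rewrite mulrA tY.
  by apply: le_trans; rewrite ler_peMl ?exprn_ge0 ?ler1n // ltW.
have tK : t * K <= delta.
  rewrite /t mulrAC ler_pdivrMr // [leRHS]mulrC -ler_pdivrMr // (le_trans _ YY0) //.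
  by rewrite /Y0 lerDr.
set m : R := #|nonunits 'Z_(p ^ l)|%:R.
have mp : m * p%:R = q by rewrite /m /q -natrM card_nonunits_Zpl.
(* After squaring and multiplying by p^d, m p = q reduces this to 2 q^(2d+2) <= 4 q^(2d+k), which
   holds as k >= 2. *)
have LM : Num.sqrt (2 * q ^+ d * m ^+ d) <= t * (n / q).
  have tn0 : 0 <= t * (n / q) by rewrite mulr_ge0 ?divr_ge0 // ltW.
  rewrite -[leRHS]ger0_norm // -sqrtr_sqr ler_wsqrtr //.
  rewrite -(ler_pM2r (exprn_gt0 d p_gt0)) -[leLHS]mulrA -exprMn mp.
  have -> : (t * (n / q)) ^+ 2 * p%:R ^+ d
      = t ^+ 2 * (n ^+ 2 * p%:R ^+ d) / q ^+ 2.
    rewrite exprMn (expr_div_n n).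
    by move: (t ^+ 2) (n ^+ 2) (q ^+ 2)^-1 (p%:R ^+ d) => a b c e; ring.
  rewrite ler_pdivlMr ?exprn_gt0 //.
  apply: le_trans (_ : t ^+ 2 * (Y ^+ 2 * q ^+ (2 * d + k)) <= _); last first.
    by rewrite ler_wpM2l // sqr_ge0.
  rewrite [leRHS]mulrA -exprMn tY -!mulrA -!exprD addnA addnn -mul2n.
  have h : q ^+ (2 * d + 2) <= q ^+ (2 * d + k).
    by rewrite ler_weXn2l // leq_add2l.
  apply: ler_pM => //; first by rewrite exprn_ge0 // ltW.
  by rewrite (le_trans h) // ler_peMl ?ler1n ?exprn_ge0 // ltW.
have us : {in alpha, forall a, a \is a GRing.unit}.
  by move=> a /tnthP[j ->].
have -> : n ^+ k.+1 / q ^+ k = n * (n / q) ^+ k.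
  by rewrite (expr_div_n n) (exprS n) mulrA.
have q_tn : q <= t * n.
  by rewrite -[leLHS]expr1 Yn // (leq_trans hk) // leq_addl.
(* The exponent 2 requires 4 <= d + k; at k = 3 this is where [d_gt0] enters. *)
have qq_tn : (2 < k)%N -> q ^+ 2 <= t * n.
  by move=> k3; apply: Yn; apply: leq_add d_gt0 k3.
have := @paths_asymp R _ d E locA t alpha us.
rewrite cardA -/m -/n -card_dot_chains size_tuple.
move=> /(_ hk t1 n_gt0 LM q_tn qq_tn) /le_trans; apply.
by rewrite ler_wpM2r // mulr_ge0 ?exprn_ge0 ?divr_ge0 // ltW.
Qed.
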